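(* Let $X,Y$ be real Banach spaces, let $T\in\mathcal{L}(X,Y)$, let $\mathcal{I},\mathcal{J}$ be ideals on $\omega$, and let $A=(A_{n,k}:n,k\in\omega)$ be a matrix of linear operators in $\mathcal{L}(X,Y)$. Consider the property $$(\ast)\quad A\in(c(X,\mathcal{I}),c(Y,\mathcal{J}))\ \text{ and }\ \mathcal{J}\text{-}\lim A\boldsymbol{x}=T(\mathcal{I}\text{-}\lim\boldsymbol{x})\ \text{ for all }\boldsymbol{x}\in c(X,\mathcal{I}),$$ and the conditions: (T1$^\flat$, for a given $k_0\in\omega$) there exists $J_0\in\mathcal{J}^\star$ for which $\sup_{n\in J_0}\|A_{n,\ge k_0}\|<\infty$ and, for all $n\in\omega\setminus J_0$, there exists $f(n)\in\omega$ such that $\|A_{n,\ge f(n)}\|<\infty$; (T1$^{\flat\flat}$) for all $n\in\omega$ there exists $f(n)\in\omega$ such that $\|A_{n,\ge f(n)}\|<\infty$; (T3$^\sharp$) $\sum_kA_{n,k}x_k$ converges in the norm of $Y$ for all $\boldsymbol{x}\in c(X,\mathcal{I})$ and $n\in\omega$; (T4) $\mathcal{J}\text{-}\lim_n\sum_kA_{n,k}=T$; (T5$^\sharp$) $A\in(c_{00}(X,\mathcal{I}),c_0(Y,\mathcal{J}))$. Then $A$ satisfies $(\ast)$ if there exists $k_0\in\omega$ such that (T1$^\flat$), (T3$^\sharp$), (T4), and (T5$^\sharp$) hold. Conversely, if $A$ satisfies $(\ast)$ then (T1$^{\flat\flat}$), (T3$^\sharp$), (T4), and (T5$^\sharp$)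 hold.
   Context: $\omega$ is the set of nonnegative integers. An ideal on $\omega$ is a family of subsets of $\omega$ closed under subsets and finite unions; every ideal is assumed to contain all finite sets and to differ from the power set of $\omega$. $\mathcal{J}^\star=\{S\subseteq\omega:\omega\setminus S\in\mathcal{J}\}$. $\mathcal{I}\text{-}\lim_nx_n=\eta$ means $\{n:x_n\notin U\}\in\mathcal{I}$ for every neighborhood $U$ of $\eta$. For a Banach space $V$: $c(V,\mathcal{I})$ is the space of $\mathcal{I}$-convergent sequences; $c_0(V,\mathcal{I})$ those with $\mathcal{I}$-limit $0$; $c_{00}(V,\mathcal{I})$ those with $\{n:x_n\ne0\}\in\mathcal{I}$ (none of these sequences need be bounded). $\mathcal{L}(X,Y)$ is the space of all (not necessarily bounded) linear operators $X\to Y$, with the strong operator topology. For $E\subseteq\omega$, the group norm is $\|A_{n,E}\|=\sup\{\|\sum_{k\in F}A_{n,k}x_k\|:F\subseteq E\text{ finite},\ x_k\in X,\ \|x_k\|\le1\}\in[0,\infty]$; $A_{n,\ge k}=A_{n,\{k,k+1,\dots\}}$. $A\boldsymbol{x}=(A_n\boldsymbol{x})_n$, $A_n\boldsymbol{x}=\sum_kA_{n,k}x_k$, provided each series converges in norm. $A\in(\mathscr{A},\mathscr{B})$ means that $A\boldsymbol{x}$ is well defined and in $\mathscr{B}$ for every $\boldsymbol{x}\in\mathscr{A}$. $\mathcal{J}\text{-}\lim_n\sum_kA_{n,k}=T$ means: for all $x\in X$ and $n\in\omega$ the series $\sum_kA_{n,k}x$ converges in norm, and $\mathcal{J}\text{-}\lim_n\sum_kA_{n,k}x=Tx$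 for all $x\in X$. *)

(* Defs.v *)
From HB Require Import structures.
From mathcomp Require Import all_boot all_order all_algebra finmap.
From mathcomp Require Import all_classical all_reals all_analysis.

Set Implicit Arguments.
Unset Strict Implicit.
Unset Printing Implicit Defensive.

Import Order.TTheory GRing.Theory Num.Theory.
Import numFieldNormedType.Exports.

Local Open Scope classical_set_scope.
Local Open Scope ring_scope.

Record is_ideal (I : set (set nat)) : Prop := IsIdeal {
  ideal_subset : forall S S' : set nat, S `<=` S' -> I S' -> I S ;
  ideal_setU : forall S S' : set nat, I S -> I S' -> I (S `|` S') ;
  ideal_finite : forall S : set nat, finite_set S -> I S ;
  ideal_proper : I <> setT }.

Definition dual_filter (I : set (set nat)) : set (set nat) :=
  [set S | I (~` S)].

Definition ideal_cvg (V : topologicalType) (I : set (set nat))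
    (x : nat -> V) (eta : V) : Prop :=
  forall U : set V, nbhs eta U -> I [set n | ~ U (x n)].

Section sequence_spaces.
Context (R : realType) (V : completeNormedModType R).

Definition c_space (I : set (set nat)) : set (nat -> V) :=
  [set x | exists eta : V, ideal_cvg I x eta].

Definition c0_space (I : set (set nat)) : set (nat -> V) :=
  [set x | ideal_cvg I x (0 : V)].

Definition c00_space (I : set (set nat)) : set (nat -> V) :=
  [set x | I [set n | x n <> 0]].

End sequence_spaces.

Section operator_matrices.
Context (R : realType) (X Y : completeNormedModType R).

(* Entries are linear but not assumed continuous. *)
Definition op_matrix := nat -> nat -> {linear X -> Y}.

Implicit Types (A : op_matrix) (x : nat -> X).

Definition group_norm A (n : nat) (E : set nat) : \bar R :=
  ereal_sup [set r : \bar R | exists (F : {fset nat}) (x : nat -> X),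
    [/\ [set` F] `<=` E, forall k, `|x k| <= 1
      & r = `|\sum_(k <- F) A n k (x k)|%:E]].

Definition tail_norm A (n k : nat) : \bar R :=
  group_norm A n [set j | (k <= j)%N].

Definition row_cvg A x (n : nat) : Prop :=
  cvgn (series (fun k => A n k (x k))).

(* Meaningful only under [row_cvg]: [limn] is total. *)
Definition mat_apply A x : nat -> Y :=
  fun n => limn (series (fun k => A n k (x k))).

Definition mat_class (SX : set (nat -> X)) (SY : set (nat -> Y)) A : Prop :=
  forall x, SX x -> (forall n, row_cvg A x n) /\ SY (mat_apply A x).

Definition row_sums_lim (J : set (set nat)) A (T : {linear X -> Y}) : Prop :=
  (forall (v : X) n, row_cvg A (fun=> v) n) /\
  (forall v : X, ideal_cvg J (mat_apply A (fun=> v)) (T v)).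

Definition limit_preserving (I J : set (set nat)) A (T : {linear X -> Y})
    : Prop :=
  mat_class (c_space I) (c_space J) A /\
  (forall x (eta : X), ideal_cvg I x eta ->
    ideal_cvg J (mat_apply A x) (T eta)).

Definition T1_flat (J : set (set nat)) A (k0 : nat) : Prop :=
  exists J0 : set nat, [/\ dual_filter J J0,
    (ereal_sup [set tail_norm A n k0 | n in J0] < +oo)%E
    & forall n, ~ J0 n -> exists f : nat, (tail_norm A n f < +oo)%E].

Definition T1_flat_flat A : Prop :=
  forall n, exists f : nat, (tail_norm A n f < +oo)%E.

Definition T3_sharp (I : set (set nat)) A : Prop :=
  forall x n, c_space I x -> row_cvg A x n.

Definition T5_sharp (I J : set (set nat)) A : Prop :=
  mat_class (c00_space I) (c0_space J) A.

End operator_matrices.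

(* Main.v *)
Require Import Defs.
From HB Require Import structures.
From mathcomp Require Import all_boot all_order all_algebra finmap.
From mathcomp Require Import all_classical all_reals all_analysis.
From mathcomp Require Import ring.

(** Sufficiency. Let [x] have limit [eta] along [I], and let [d > 0]. The
    indices [k >= k0] with [`|x k - eta| <= d] form a set [G] whose complement
    is in [I]. Write [x = eta + z1 + z2], where [z1] and [z2] are [x - eta]
    cut down to the complement of [G] and to [G]. The image of the
    constant sequence [eta] has limit [T eta]; [z1] is supported
    in a set of [I], so its image has limit 0; and [z2] is bounded by [d] and
    vanishes before [k0], so on a set of the dual filter of [J] its image is
    bounded by [d] times the common bound of the tail norms
    ([mat_apply_tail_le]). As [d] is arbitrary, the limit of the image of [x]
    is [T eta].

    Necessity. Constant sequences and sequences supported in a set of [I] are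
    convergent along [I], which yields all conditions but the one on tail
    norms. If all tail norms of one row are infinite, then beyond every index
    there is a finite block of arbitrarily small entries whose image under the
    row has norm more than 1 ([tail_norm_block]). Concatenating such blocks
    ([gliding_hump]) gives a sequence that converges to 0 in the ordinary
    sense, hence along [I], and on which the row diverges. *)

Set Implicit Arguments.
Unset Strict Implicit.
Unset Printing Implicit Defensive.

Import Order.TTheory GRing.Theory Num.Theory.
Import numFieldNormedType.Exports.

Local Open Scope classical_set_scope.
Local Open Scope ring_scope.

(** * Ideals as filters *)

(** Convergence along an ideal is literally filter convergence along the dual
    filter, so the general calculus of limits applies to it. *)
Lemma dual_filter_filter (I : set (set nat)) :
  is_ideal I -> Filter (dual_filter I : set_system nat).
Proof.
move=> hI; split; rewrite /dual_filter /=.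
- by rewrite setCT; apply: (ideal_finite hI).
- by move=> P Q IP IQ /=; rewrite setCI; apply: (ideal_setU hI).
- by move=> P Q PQ; apply: (ideal_subset hI); exact: subsetC.
Qed.

Lemma ideal_cvgE (V : topologicalType) (I : set (set nat)) (x : nat -> V)
  (eta : V) : ideal_cvg I x eta = (x @ (dual_filter I : set_system nat) --> eta).
Proof. by []. Qed.

Lemma dual_filter_ge (I : set (set nat)) (m : nat) :
  is_ideal I -> dual_filter I [set k | (m <= k)%N].
Proof.
move=> hI; apply: (ideal_finite hI).
apply: (sub_finite_set _ (finite_II m)) => k /=.
by move/negP; rewrite -ltnNge.
Qed.

Lemma cvg_ideal_cvg (V : topologicalType) (I : set (set nat)) (x : nat -> V)
  (eta : V) : is_ideal I -> x @ \oo --> eta -> ideal_cvg I x eta.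
Proof.
move=> hI xeta U /xeta [m _ mU].
apply: (ideal_subset hI _ (dual_filter_ge m hI)) => k /= nUk /= mk.
exact/nUk/mU.
Qed.

Lemma ideal_cvg_cst (V : topologicalType) (I : set (set nat)) (v : V) :
  is_ideal I -> ideal_cvg I (fun=> v) v.
Proof. by move=> hI; apply: cvg_ideal_cvg => //; exact: cvg_cst. Qed.

Lemma c00_ideal_cvg0 (R : realType) (V : completeNormedModType R)
  (I : set (set nat)) (x : nat -> V) :
  is_ideal I -> c00_space I x -> ideal_cvg I x 0.
Proof.
move=> hI Ix U U0; apply: (ideal_subset hI _ Ix) => k /= nU xk0.
by apply: nU; rewrite xk0; exact: nbhs_singleton.
Qed.

(** * Rows of an operator matrix *)

Section rows.
Context (R : realType) (X Y : completeNormedModType R).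
Implicit Types (A : op_matrix X Y) (x y : nat -> X).

Lemma series_rowB A n x y :
  series (fun k => A n k ((x - y) k)) =
  series (fun k => A n k (x k)) - series (fun k => A n k (y k)).
Proof.
rewrite -seriesN -seriesD; congr series.
by apply/funext => k; rewrite linearB.
Qed.

Lemma row_cvgB A n x y :
  row_cvg A x n -> row_cvg A y n -> row_cvg A (x - y) n.
Proof. by rewrite /row_cvg series_rowB => cx cy; exact: is_cvgB. Qed.

Lemma mat_applyB A n x y : row_cvg A x n -> row_cvg A y n ->
  mat_apply A (x - y) n = mat_apply A x n - mat_apply A y n.
Proof. by rewrite /mat_apply series_rowB => cx cy; exact: limB. Qed.

(** A row annihilates the entries of [x] before [k0] when they vanish, and the
    rest of every partial sum is one of the finite sums measured by the tail
    norm, up to the factor [e]. *)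
Lemma mat_apply_tail_le A n k0 (c e : R) x : (tail_norm A n k0 <= c%:E)%E ->
  0 < e -> (forall k, (k < k0)%N -> x k = 0) -> (forall k, `|x k| <= e) ->
  row_cvg A x n -> `|mat_apply A x n| <= c * e.
Proof.
move=> Ac e0 x0 xe cx; rewrite /mat_apply -lim_norm//.
apply: limr_le; first exact: is_cvg_norm.
apply: nearW => N; rewrite /series /=.
pose F := [fset k in [seq k <- index_iota 0 N | (k0 <= k)%N]]%fset.
have sumF : \sum_(0 <= k < N) A n k (x k) = \sum_(k <- F) A n k (x k).
  rewrite [RHS](perm_big [seq k <- index_iota 0 N | (k0 <= k)%N]); last first.
    apply: uniq_perm; rewrite ?fset_uniq ?filter_uniq ?iota_uniq//.
    by move=> k; rewrite in_fset.
  rewrite big_filter [RHS]big_mkcond /=; apply: eq_bigr => k _.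
  by case: leqP => // /x0 ->; rewrite linear0.
rewrite sumF.
pose u k := e^-1 *: x k.
have -> : \sum_(k <- F) A n k (x k) = e *: \sum_(k <- F) A n k (u k).
  rewrite scaler_sumr; apply: eq_bigr => k _.
  by rewrite /u linearZ scalerA divff ?gt_eqF// scale1r.
rewrite normrZ gtr0_norm// mulrC ler_pM2r// -lee_fin.
apply: le_trans Ac; apply: ereal_sup_ubound; exists F, u; split => //.
- by move=> k /=; rewrite in_fset mem_filter => /andP[].
- move=> k; rewrite /u normrZ gtr0_norm ?invr_gt0//.
  by rewrite mulrC ler_pdivrMr// mul1r.
Qed.

(** An infinite tail norm is witnessed by arbitrarily large finite sums;
    scaling turns one of them into a block of small entries whose image has
    norm more than 1. *)
Lemma tail_norm_block A n m (c : R) : 0 < c -> tail_norm A n m = +oo%E ->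
  exists (N : nat) (y : nat -> X), [/\ (m < N)%N, forall k, `|y k| <= c
    & 1 < `|\sum_(m <= k < N) A n k (y k)|].
Proof.
move=> c0 Aoo.
have : ((c^-1)%:E < tail_norm A n m)%E by rewrite Aoo ltry.
move=> /ereal_sup_gt[_ [F [x [mF x1 ->]]]]; rewrite lte_fin => cF.
exists (maxn m (\max_(k <- F) k)).+1.
exists (fun k => if k \in F then c *: x k else 0); split.
- by rewrite ltnS leq_maxl.
- move=> k; case: ifP => _; last by rewrite normr0 ltW.
  by rewrite normrZ gtr0_norm// ler_piMr// ltW.
- set N := (X in \sum_(_ <= _ < X) _).
  have FN k : k \in F -> (m <= k < N)%N.
    move=> kF; rewrite (mF k kF) ltnS leq_max.
    by rewrite (@leq_bigmax_seq _ (enum_fset F) xpredT id k)// orbT.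
  have -> : \sum_(m <= k < N) A n k (if k \in F then c *: x k else 0) =
            c *: \sum_(k <- F) A n k (x k).
    rewrite [in RHS](perm_big [seq k <- index_iota m N | k \in F]); last first.
      apply: uniq_perm; rewrite ?fset_uniq ?filter_uniq ?iota_uniq//.
      move=> k; rewrite mem_filter mem_index_iota.
      by case: (boolP (k \in F)) => // /FN ->.
    rewrite scaler_sumr big_filter [RHS]big_mkcond /=; apply: eq_bigr => k _.
    by case: ifP => _; rewrite ?linearZ ?linear0.
  by rewrite normrZ gtr0_norm// -ltr_pdivrMl// mulr1.
Qed.

End rows.

(** * The gliding hump *)

(** Concatenating blocks, each starting where the previous one ends, produces a
    null sequence, since the bound on the entries of a block shrinks with its
    starting index. The images of the blocks have norm more than 1, so the
    Cauchy criterion fails. *)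
Lemma gliding_hump (R : realType) (X Y : completeNormedModType R)
    (L : nat -> X -> Y) :
  (forall m, exists (N : nat) (y : nat -> X), [/\ (m < N)%N,
    forall k, `|y k| <= m.+1%:R^-1 & 1 < `|\sum_(m <= k < N) L k (y k)|]) ->
  exists z : nat -> X,
    z @ \oo --> (0 : X) /\ ~ cvgn (series (fun k => L k (z k))).
Proof.
move=> /choice[next] /choice[y blk].
have next_gt m : (m < next m)%N by case: (blk m).
have y_le m k : `|y m k| <= m.+1%:R^-1 by case: (blk m).
have y_gt m : 1 < `|\sum_(m <= k < next m) L k (y m k)| by case: (blk m).
(* s k is the start of the block containing k. *)
pose s := fix s k := if k is k'.+1 then
  if k == next (s k') then k else s k' else 0%N.
have sS k : s k.+1 = if k.+1 == next (s k) then k.+1 else s k by [].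
have s_le k : (s k <= k)%N.
  by elim: k => // k IH; rewrite sS; case: ifP => // _; exact: leqW.
have s_nd k : (s k <= s k.+1)%N by rewrite sS; case: ifP => // _; exact: leqW.
have {}s_nd k l : (k <= l)%N -> (s k <= s l)%N.
  by move=> kl; apply: (@homo_leq _ s leq) kl => //; exact: leq_trans.
have s_block m j : s m = m -> (m + j < next m)%N -> s (m + j)%N = m.
  move=> sm; elim: j => [|j IH]; first by rewrite addn0.
  rewrite addnS => lt_next; rewrite sS IH ?(ltnW lt_next)//.
  by rewrite ltn_eqF.
have s_next m : s m = m -> s (next m) = next m.
  move=> sm; have := next_gt m; case E: (next m) => [//|k] mk.
  have sk : s k = m.
    by rewrite -(subnKC (ltnSE mk)) s_block// subnKC ?E// ltnSE.
  by rewrite sS sk E eqxx.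
have s_cofinal M : exists m, (M <= m)%N /\ s m = m.
  elim: M => [|M [m [Mm sm]]]; first by exists 0%N.
  exists (next m); split; last exact: s_next.
  exact: leq_ltn_trans Mm (next_gt m).
exists (fun k => y (s k) k); split.
  apply/cvgr0Pnorm_lt => e e0.
  have [M _ Me] := near_infty_natSinv_lt (PosNum e0).
  have [m [Mm sm]] := s_cofinal M.
  exists m => // k /= mk; apply: le_lt_trans (y_le _ _) _.
  by apply: Me => /=; apply: leq_trans Mm _; rewrite -sm s_nd.
move=> /cvg_cauchy/cauchy_seriesP/(_ 1 ltr01).
case=> -[P Q] /= [[a _ aP] [b _ bQ]] PQ.
have [m [abm sm]] := s_cofinal (maxn a b).
move: abm; rewrite geq_max => /andP[am bm].
have /PQ /= : (P `*` Q) (m, next m).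
  by split => /=; [exact: aP|apply: bQ; exact: leq_trans bm (ltnW (next_gt m))].
apply/negP; rewrite -leNgt ltW//.
rewrite (eq_big_nat _ _ (F2 := fun k => L k (y m k)))// => k /andP[mk kn].
by rewrite -(subnKC mk) s_block// subnKC.
Qed.

(** * Sufficiency and necessity *)

Section main.
Context (R : realType) (X Y : completeNormedModType R).
Context (I J : set (set nat)) (hI : is_ideal I) (hJ : is_ideal J).
Implicit Types (A : op_matrix X Y) (T : {linear X -> Y}).

(** The tail norms are only controlled uniformly from [k0] on, but replacing
    finitely many entries of a sequence by 0 changes it by an element of
    [c00_space I], and such changes are absorbed by the hypothesis on that
    space. *)
Lemma limit_preserving_of_tails A T k0 :
  T1_flat J A k0 -> T3_sharp I A -> row_sums_lim J A T -> T5_sharp I J A ->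
  limit_preserving I J A T.
Proof.
move=> [J0 [JJ0 supJ0 _]] T3 [T4c T4] T5.
have FI := dual_filter_filter hI; have FJ := dual_filter_filter hJ.
(* The maximum with 1 makes c positive, so that d below is as well. *)
have [c c0 tail_c] : exists2 c : R, 0 < c &
    forall n, J0 n -> (tail_norm A n k0 <= c%:E)%E.
  set S := [set tail_norm A n k0 | n in J0] in supJ0.
  exists (Num.max 1 (fine (ereal_sup S))); first by rewrite lt_max ltr01.
  move=> n J0n; apply: (@le_trans _ _ (ereal_sup S)).
    by apply: ereal_sup_ubound; exists n.
  case: (ereal_sup S) supJ0 => [r| |] //=; last by rewrite leNye.
  by rewrite lee_fin le_max lexx orbT.
suff lim x eta : ideal_cvg I x eta -> ideal_cvg J (mat_apply A x) (T eta).
  split=> // x [eta xeta]; split; last by exists (T eta); exact: lim.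
  by move=> n; apply: T3; exists eta.
rewrite !ideal_cvgE => xeta; apply/cvgrPdist_lt => e e0.
pose d := e / (3 * c).
have d0 : 0 < d by rewrite divr_gt0// mulr_gt0.
(* Sequences are compared on a set G of the dual filter that avoids the
   first k0 indices: z2 is x - eta on G and 0 elsewhere, z1 the reverse. *)
pose G := [set k | `|eta - x k| <= d] `&` [set k | (k0 <= k)%N].
have IG : dual_filter I G.
  apply: filterI; last exact: dual_filter_ge.
  by move/cvgrPdist_le : xeta => /(_ _ d0).
pose z1 k := if k \in G then 0 else x k - eta.
pose z2 := x - cst eta - z1.
have c00z1 : c00_space I z1.
  apply: (ideal_subset hI _ IG) => k /=.
  by rewrite /z1; case: ifPn => //; rewrite notin_setE.
have [rz1 z1_lim] := T5 _ c00z1.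
have rx n : row_cvg A x n by apply: T3; exists eta.
have reta n : row_cvg A (cst eta) n by exact: T4c.
have rz2 n : row_cvg A z2 n by do 2?apply: row_cvgB.
have xE n : mat_apply A x n =
    mat_apply A (cst eta) n + mat_apply A z1 n + mat_apply A z2 n.
  rewrite /z2 !mat_applyB//; last exact: row_cvgB.
  by rewrite -[_ - _ - _]addrA -opprD subrKC.
have z2_le n : J0 n -> `|mat_apply A z2 n| <= e / 3.
  move=> J0n; have -> : e / 3 = c * d.
    by rewrite /d; field; rewrite gt_eqF.
  apply: (mat_apply_tail_le (tail_c n J0n)) => // k.
  - move=> kk0; rewrite /z2 /z1 !fctE /=; case: ifPn; last by rewrite subrr.
    by rewrite inE => -[_ /=]; rewrite leqNgt kk0.
  - rewrite /z2 /z1 !fctE /=; case: ifPn; last by rewrite subrr normr0 ltW.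
    by rewrite inE subr0 distrC => -[].
have e3 : 0 < e / 3 by rewrite divr_gt0.
have Jeta : dual_filter J [set n | `|T eta - mat_apply A (cst eta) n| < e / 3].
  by have := T4 eta; rewrite ideal_cvgE => /cvgrPdist_lt/(_ _ e3).
have Jz1 : dual_filter J [set n | `|0 - mat_apply A z1 n| < e / 3].
  by move: z1_lim; rewrite /c0_space /= ideal_cvgE => /cvgrPdist_lt/(_ _ e3).
apply: filterS (filterI JJ0 (filterI Jeta Jz1)) => n [J0n [/= h1 h2]].
have -> : T eta - mat_apply A x n = (T eta - mat_apply A (cst eta) n)
    + (0 - mat_apply A z1 n) - mat_apply A z2 n.
  by rewrite xE !opprD sub0r !addrA.
have -> : e = e / 3 + e / 3 + e / 3 by field.
apply: le_lt_trans (ler_normB _ _) _; apply: ltr_leD (z2_le n J0n).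
by apply: le_lt_trans (ler_normD _ _) _; exact: ltrD.
Qed.

(** If some row had only infinite tail norms, the gliding hump would give a
    null sequence on which that row diverges. *)
Lemma T3_sharp_T1_flat_flat A : T3_sharp I A -> T1_flat_flat A.
Proof.
move=> T3 n; apply: contrapT => tails.
have Aoo m : tail_norm A n m = +oo%E.
  by apply/eqP; apply: contra_notT tails; rewrite -ltey; exists m.
have [m|z [z0]] := @gliding_hump R X Y (A n).
  by apply: tail_norm_block (Aoo m); rewrite invr_gt0.
by apply; apply: T3; exists 0; exact: cvg_ideal_cvg.
Qed.

Lemma limit_preserving_conditions A T : limit_preserving I J A T ->
  [/\ T1_flat_flat A, T3_sharp I A, row_sums_lim J A T & T5_sharp I J A].
Proof.
move=> [cA limA].
have T3 : T3_sharp I A by move=> x n /cA[].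
split=> //; first exact: T3_sharp_T1_flat_flat.
- split=> v; last by apply: limA; exact: ideal_cvg_cst.
  by move=> n; apply: T3; exists v; exact: ideal_cvg_cst.
- move=> x /(c00_ideal_cvg0 hI) x0; split.
    by move=> n; apply: T3; exists 0.
  by have := limA _ _ x0; rewrite linear0.
Qed.

End main.

Theorem theorem2p20 (R : realType) (X Y : completeNormedModType R)
    (T : {linear X -> Y}) (I J : set (set nat))
    (hI : is_ideal I) (hJ : is_ideal J) (A : nat -> nat -> {linear X -> Y}) :
  ((exists k0 : nat,
      [/\ T1_flat J A k0, T3_sharp I A, row_sums_lim J A T & T5_sharp I J A]) ->
    limit_preserving I J A T) /\
  (limit_preserving I J A T ->
    [/\ T1_flat_flat A, T3_sharp I A, row_sums_lim J A T & T5_sharp I J A]).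
Proof.
split; last exact: limit_preserving_conditions.
by move=> [k0 [T1 T3 T4 T5]]; exact: limit_preserving_of_tails T1 T3 T4 T5.
Qed.
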